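(* Let $H$ be an infinite dimensional real or complex Hilbert space and let $\phi:P_\infty(H)\to P_\infty(H)$ be a surjective map such that $\angle(\phi(P),\phi(Q))=\angle(P,Q)$ for all $P,Q\in P_\infty(H)$. Then there exists a unitary or antiunitary operator $U$ on $H$ such that $\phi(P)=UPU^*$ for all $P\in P_\infty(H)$.
   Context: A projection means a self-adjoint idempotent bounded operator on $H$; $P_\infty(H)$ is the set of all projections of infinite rank. For projections $P,Q,P',Q'$, ''$\angle(P,Q)=\angle(P',Q')$'' means by definition that the positive operators $QPQ$ and $Q'P'Q'$ are unitarily equivalent (orthogonally equivalent in the real case). In the real case ''unitary or antiunitary'' means orthogonal. *)

(* Defs.v *)
From mathcomp Require Import all_boot all_algebra.
From mathcomp Require Import reals.
From mathcomp Require Import complex.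
Set Implicit Arguments. Unset Strict Implicit. Unset Printing Implicit Defensive.
Import GRing.Theory Num.Theory.
Local Open Scope ring_scope.

Section HilbertDefs.
Variables (K : numFieldType) (cj : K -> K) (V : lmodType K) (ip : V -> V -> K).

(* ip is an inner product (linear in the 1st argument, cj-symmetric,
   positive definite); cj = id (real case) or complex conjugation. *)
Definition is_inner_product : Prop :=
  [/\ forall (a : K) (x y z : V), ip (a *: x + y) z = a * ip x z + ip y z,
      forall x y, ip y x = cj (ip x y),
      forall x, 0 <= ip x x
    & forall x, ip x x = 0 -> x = 0].

Definition ip_complete : Prop :=
  forall u : nat -> V,
    (forall e : K, 0 < e -> exists N, forall m n, (N <= m)%N -> (N <= n)%N ->
        `|ip (u m - u n) (u m - u n)| < e) ->
    exists l : V, forall e : K, 0 < e -> exists N, forall n, (N <= n)%N ->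
        `|ip (u n - l) (u n - l)| < e.

Definition is_hilbert : Prop := is_inner_product /\ ip_complete.

Definition lin_indep (n : nat) (e : 'I_n -> V) : Prop :=
  forall c : 'I_n -> K, \sum_(i < n) c i *: e i = 0 -> forall i, c i = 0.

Definition infinite_dimensional (S : V -> Prop) : Prop :=
  forall n : nat, exists e : 'I_n -> V, (forall i, S (e i)) /\ lin_indep e.

Definition semilinear (s : K -> K) (f : V -> V) : Prop :=
  forall (a : K) (x y : V), f (a *: x + y) = s a *: f x + f y.

Definition bounded_op (T : V -> V) : Prop :=
  exists M : K, forall x, `|ip (T x) (T x)| <= M * `|ip x x|.

Definition is_projection (P : V -> V) : Prop :=
  [/\ semilinear id P, bounded_op P, forall x, P (P x) = P x
    & forall x y, ip (P x) y = ip x (P y)].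

Definition proj_inf (P : V -> V) : Prop :=
  is_projection P /\ infinite_dimensional (fun y => exists x, P x = y).

Definition isometric_onto (s : K -> K) (U : V -> V) : Prop :=
  [/\ semilinear s U, forall y, exists x, U x = y
    & forall x y, ip (U x) (U y) = s (ip x y)].

Definition unitary (U : V -> V) : Prop := isometric_onto id U.
Definition antiunitary (U : V -> V) : Prop := isometric_onto cj U.

(* angle(P,Q) = angle(P',Q') : QPQ and Q'P'Q' are unitarily equivalent,
   i.e. Q'P'Q' = W (QPQ) W^* for a unitary W (W^* = W^{-1}) *)
Definition same_angle (P Q P' Q' : V -> V) : Prop :=
  exists W Wstar : V -> V, [/\ unitary W, cancel W Wstar, cancel Wstar W
    & forall x, Q' (P' (Q' x)) = W (Q (P (Q (Wstar x))))].

Definition theorem4_body : Prop :=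
  is_hilbert -> infinite_dimensional (fun _ => True) ->
  forall phi : (V -> V) -> (V -> V),
    (forall P, proj_inf P -> proj_inf (phi P)) ->
    (forall Q, proj_inf Q -> exists P, proj_inf P /\ phi P = Q) ->
    (forall P Q, proj_inf P -> proj_inf Q -> same_angle P Q (phi P) (phi Q)) ->
    exists U Ustar : V -> V,
      [/\ unitary U \/ antiunitary U, cancel U Ustar, cancel Ustar U
        & forall P, proj_inf P -> forall x, phi P x = U (P (Ustar x))].

End HilbertDefs.

(* Main.v *)
(** Call a projection bi-infinite when its range and its kernel are infinite
    dimensional.  [phi] preserves orthogonality in both directions, and below a
    bi-infinite [Q] the relation [P <= Q] means orthogonality to the complement
    of [Q]; so on bi-infinite projections [phi] is an order automorphism that
    commutes with complements.

    If [A] is bi-infinite and [A x = 0], compressing the complement of [A] to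
    [Q = A + [x]] gives the rank one projection [[x]]; preservation of this
    angle yields [phi (A + [x]) = phi A + [v]] with [v] of the norm of [x].  For
    orthogonal [A] and [B], compressing [B + [y]] to [A + [x]] gives a multiple
    of [[x]] whose factor is the transition probability of [x] and [y], so
    transition probabilities are preserved.  With [x = y] this says that the
    line of [v] is the same for [A] and [B], and any two bi-infinite projections
    dominate an orthogonal pair.  The induced map of lines satisfies the
    hypothesis of Wigner's theorem, which provides [U] implementing [phi] on
    bi-infinite projections.

    If [P] has finite corank and [P' = U^* phi(P) U], every bi-infinite [A <= P]
    commutes with [P'].  The lines in the range of [P] are differences of such
    [A], so [P'] fixes or kills every vector there and hence fixes all of them;
    this gives [P <= P'], and the reverse inequality is symmetric. *)
Require Import Defs.
From mathcomp Require Import all_boot all_order all_algebra.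
From mathcomp Require Import boolp classical_sets reals complex ring.
Set Implicit Arguments. Unset Strict Implicit. Unset Printing Implicit Defensive.
Import Order.TTheory GRing.Theory Num.Theory.
Local Open Scope ring_scope.

Lemma two_subgroup_cover (G : zmodType) (M A B : G -> Prop) :
  (forall x y, M x -> M y -> M (x + y)) ->
  (forall x y, M x -> M y -> A x -> A y -> A (x - y)) ->
  (forall x y, M x -> M y -> B x -> B y -> B (x - y)) ->
  (forall x, M x -> A x \/ B x) ->
  (forall x, M x -> A x) \/ (forall x, M x -> B x).
Proof.
move=> MD A_sub B_sub MAB.
have [MA|] := pselect (forall x, M x -> A x); first by left.
move=> /existsNP[a /not_implyP[Ma nAa]]; right => b Mb.
have Ba : B a by have [] := MAB a Ma.
have [Ab|//] := MAB b Mb; have [Aab|Bab] := MAB _ (MD a b Ma Mb).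
  by case: nAa; rewrite -(addrK b a); apply: A_sub => //; exact: MD.
by rewrite -(addKr a b) addrC; apply: B_sub => //; exact: MD.
Qed.

Section Scalars.
Variable K : numFieldType.
Implicit Types a b e : K.

Definition inf_complete : Prop := forall S : K -> Prop,
  (exists a, S a) -> (forall a, S a -> 0 <= a) ->
  exists g, (forall a, S a -> g <= a) /\
    forall e, 0 < e -> exists2 a, S a & a < g + e.

Lemma inf_complete_archimedean : inf_complete ->
  forall e, 0 < e -> exists n, n.+1%:R^-1 < e.
Proof.
move=> K_inf e e_gt0.
have [||g [g_le g_approx]] := K_inf (fun a => exists n, a = n.+1%:R^-1).
- by exists 1%:R^-1, 0%N.
- by move=> _ [n ->]; rewrite invr_ge0.
have g_real : g \is Num.real.
  by rewrite (ler_real (g_le 1%:R^-1 _)) ?rpredV ?realn //; exists 0%N.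
have [_ [n ->] lt_ge] := g_approx e e_gt0; exists n.
apply: lt_le_trans lt_ge _; rewrite gerDr real_leNgt ?real0 //.
apply/negP => g_gt0; have [_ [m ->] m_lt] := g_approx g g_gt0.
have g_half : g <= (m.*2.+1).+1%:R^-1 by apply: g_le; exists m.*2.+1.
have := lt_le_trans m_lt (lerD g_half g_half).
have -> : (m.*2.+1).+1%:R = 2 * m.+1%:R :> K by rewrite -natrM mul2n doubleS.
have -> : (2 * m.+1%:R)^-1 + (2 * m.+1%:R)^-1 = m.+1%:R^-1 :> K.
  by field; rewrite nat1r pnatr_eq0.
by rewrite ltxx.
Qed.

Lemma invn_eventually_lt : inf_complete ->
  forall e, 0 < e -> exists N, forall n, (N <= n)%N -> n.+1%:R^-1 < e.
Proof.
move=> K_inf e /(inf_complete_archimedean K_inf)[N N_lt]; exists N => n le_Nn.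
by apply: le_lt_trans N_lt; rewrite lef_pV2 ?posrE ?ltr0n // ler_nat ltnS.
Qed.

Lemma eq0_le_scaled a b : 0 <= a -> 0 <= b ->
  (forall e, 0 < e -> a <= b * e) -> a = 0.
Proof.
move=> a_ge0 b_ge0 a_le; apply/eqP/negPn/negP => a_neq0.
have a_gt0 : 0 < a by rewrite lt_def a_neq0.
have b1_gt0 : 0 < b + 1 by rewrite ltr_wpDl.
have := a_le (a / (b + 1)) (divr_gt0 a_gt0 b1_gt0).
by rewrite mulrA ler_pdivlMr // mulrDr mulr1 mulrC gerDl lt_geF.
Qed.

Lemma normD_sqr_le a b : `|a + b| ^+ 2 <= 2 * `|a| ^+ 2 + 2 * `|b| ^+ 2.
Proof.
apply: (@le_trans _ _ ((`|a| + `|b|) ^+ 2)).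
  by rewrite lerXn2r ?nnegrE ?addr_ge0 ?ler_normD.
rewrite -subr_ge0 [leRHS](_ : _ = (`|a| - `|b|) ^+ 2); last by ring.
by rewrite real_exprn_even_ge0 // rpredB ?normr_real.
Qed.

End Scalars.

Section ScalarConjugation.
Variables (K : numFieldType) (cj : {rmorphism K -> K}).
Hypothesis mul_cj : forall z : K, z * cj z = `|z| ^+ 2.
Implicit Types a b k : K.

Lemma cj_ge0 a : 0 <= a -> cj a = a.
Proof.
move=> a_ge0; have [->|a_neq0] := eqVneq a 0; first exact: rmorph0.
by apply: (mulfI a_neq0); rewrite mul_cj ger0_norm // expr2.
Qed.

Lemma cjK : involutive cj.
Proof.
move=> a; have [->|a_neq0] := eqVneq a 0; first by rewrite !rmorph0.
have cja_neq0 : cj a != 0 by rewrite fmorph_eq0.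
apply: (mulfI cja_neq0); rewrite -rmorphM mul_cj.
by rewrite (cj_ge0 (exprn_ge0 2 (normr_ge0 a))) -mul_cj mulrC.
Qed.

Lemma norm_cj a : `|cj a| = `|a|.
Proof. by apply/eqP; rewrite -(eqrXn2 (n := 2)) // -!mul_cj cjK mulrC. Qed.

Lemma eq_norm_mul_cj a b : `|a| = `|b| -> a * cj a = b * cj b.
Proof. by rewrite !mul_cj => ->. Qed.

Definition cj_trace a : K := a + cj a.

Lemma eq_cj_trace k a b : 0 < k ->
  `|k + a| = `|k + b| -> `|a| = `|b| -> cj_trace a = cj_trace b.
Proof.
move=> k_gt0 /eq_norm_mul_cj eq_kab /eq_norm_mul_cj eq_ab.
rewrite !rmorphD /= (cj_ge0 (ltW k_gt0)) in eq_kab.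
have k_neq0 : k != 0 by rewrite gt_eqF.
apply: (mulfI k_neq0); rewrite /cj_trace.
have -> : k * (a + cj a) = (k + a) * (k + cj a) - k ^+ 2 - a * cj a by ring.
by rewrite eq_kab eq_ab; ring.
Qed.

Lemma cj_trace_norm_eq a b : cj_trace a = cj_trace b -> `|a| = `|b| ->
  b = a \/ b = cj a.
Proof.
rewrite /cj_trace => eq_tr /eq_norm_mul_cj eq_ab.
have /eqP : (b - a) * (b - cj a) = 0.
  have -> : (b - a) * (b - cj a) = b ^+ 2 - b * (a + cj a) + a * cj a by ring.
  by rewrite eq_tr eq_ab; ring.
by rewrite mulf_eq0 !subr_eq0 => /orP[] /eqP; [left | right].
Qed.

Definition id_or_cj (s : K -> K) : Prop := s = idfun \/ s = cj.

Lemma id_or_cjK s : id_or_cj s -> involutive s.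
Proof. by case=> -> //; exact: cjK. Qed.

Lemma norm_id_or_cj s a : id_or_cj s -> `|s a| = `|a|.
Proof. by case=> -> //; exact: norm_cj. Qed.

Lemma cj_id_or_cj s a : id_or_cj s -> cj (s a) = s (cj a).
Proof. by case=> ->. Qed.

Lemma id_or_cj_ge0 s a : id_or_cj s -> 0 <= a -> s a = a.
Proof. by case=> -> //; exact: cj_ge0. Qed.

End ScalarConjugation.

Section Semilinear.
Variables (K : numFieldType) (V : lmodType K).
Variables (s : {rmorphism K -> K}) (f : V -> V).
Hypothesis f_semilinear : Defs.semilinear s f.
Implicit Types (S : V -> Prop) (x y : V) (a : K).

Lemma semilinearD x y : f (x + y) = f x + f y.
Proof. by rewrite -{1}[x]scale1r f_semilinear rmorph1 scale1r. Qed.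

Lemma semilinear0 : f 0 = 0.
Proof. by apply: (addrI (f 0)); rewrite -semilinearD !addr0. Qed.

Lemma semilinearZ a x : f (a *: x) = s a *: f x.
Proof. by rewrite -[a *: x]addr0 f_semilinear semilinear0 addr0. Qed.

Lemma semilinearB x y : f (x - y) = f x - f y.
Proof. by apply: (addIr (f y)); rewrite -semilinearD !subrK. Qed.

Lemma semilinear_sum (I : finType) (c : I -> K) (x : I -> V) :
  f (\sum_i c i *: x i) = \sum_i s (c i) *: f (x i).
Proof.
rewrite (big_morph f semilinearD semilinear0).
by apply: eq_bigr => i _; rewrite semilinearZ.
Qed.

Lemma infinite_dimensional_semilinear S S' : involutive s ->
  (forall x, f x = 0 -> x = 0) -> (forall x, S x -> S' (f x)) ->
  infinite_dimensional S -> infinite_dimensional S'.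
Proof.
move=> sK f_inj SS' S_inf n; have [e [Se e_indep]] := S_inf n.
exists (f \o e); split=> [i|c sum0 i]; first exact/SS'/Se.
apply: (can_inj sK); rewrite rmorph0.
apply: (e_indep (s \o c)); apply: f_inj; rewrite semilinear_sum -[RHS]sum0.
by apply: eq_bigr => j _; rewrite /= sK.
Qed.

End Semilinear.

Section Subspaces.
Variables (K : numFieldType) (V : lmodType K).
Implicit Types (S : V -> Prop) (x y : V).

Lemma infinite_dimensional_sub S S' : (forall x, S x -> S' x) ->
  infinite_dimensional S -> infinite_dimensional S'.
Proof.
move=> SS' S_inf n; have [e [Se e_indep]] := S_inf n.
by exists e; split=> // i; exact: SS'.
Qed.

Definition subspace S : Prop :=
  S 0 /\ forall (a : K) x y, S x -> S y -> S (a *: x + y).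

Lemma subspaceD S x y : subspace S -> S x -> S y -> S (x + y).
Proof. by move=> [_ S_lin] Sx Sy; rewrite -[x]scale1r; exact: S_lin. Qed.

Lemma subspaceZ S a x : subspace S -> S x -> S (a *: x).
Proof. by move=> [S0 S_lin] Sx; rewrite -[_ *: _]addr0; exact: S_lin. Qed.

Lemma subspaceB S x y : subspace S -> S x -> S y -> S (x - y).
Proof.
move=> S_sub Sx Sy; rewrite -scaleN1r.
by apply: subspaceD => //; exact: subspaceZ.
Qed.

Lemma subspace_sum S (I : finType) (c : I -> K) (x : I -> V) :
  subspace S -> (forall i, S (x i)) -> S (\sum_i c i *: x i).
Proof. by move=> [S0 S_lin] Sx; apply: big_rec => // i y _; exact: S_lin. Qed.

End Subspaces.

Section InnerProduct.
Variables (K : numFieldType) (cj : {rmorphism K -> K}).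
Hypothesis mul_cj : forall z : K, z * cj z = `|z| ^+ 2.
Variables (V : lmodType K) (ip : V -> V -> K).
Hypothesis ipP : is_inner_product cj ip.
Implicit Types (S M : V -> Prop) (x y z u v w : V) (a b c d e k : K) (n : nat).

Lemma ip_lin a x y z : ip (a *: x + y) z = a * ip x z + ip y z.
Proof. by case: ipP. Qed.

Lemma ipC x y : ip y x = cj (ip x y).
Proof. by case: ipP. Qed.

Lemma ip_ge0 x : 0 <= ip x x.
Proof. by case: ipP. Qed.

Lemma ip_eq0 x : ip x x = 0 -> x = 0.
Proof. by case: ipP => _ _ _; apply. Qed.

Lemma ipDl x y z : ip (x + y) z = ip x z + ip y z.
Proof. by have := ip_lin 1 x y z; rewrite scale1r mul1r. Qed.

Lemma ip0l z : ip 0 z = 0.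
Proof. by apply: (addrI (ip 0 z)); rewrite -ipDl !addr0. Qed.

Lemma ipZl a x z : ip (a *: x) z = a * ip x z.
Proof. by have := ip_lin a x 0 z; rewrite ip0l !addr0. Qed.

Lemma ipNl x z : ip (- x) z = - ip x z.
Proof. by rewrite -scaleN1r ipZl mulN1r. Qed.

Lemma ipDr x y z : ip z (x + y) = ip z x + ip z y.
Proof. by rewrite ipC ipDl rmorphD -!ipC. Qed.

Lemma ip0r z : ip z 0 = 0.
Proof. by rewrite ipC ip0l rmorph0. Qed.

Lemma ipZr a x z : ip z (a *: x) = cj a * ip z x.
Proof. by rewrite ipC ipZl rmorphM -ipC. Qed.

Lemma ipNr x z : ip z (- x) = - ip z x.
Proof. by rewrite ipC ipNl rmorphN -ipC. Qed.

Definition ipE := (ipDl, ipZl, ipNl, ip0l, ipDr, ipZr, ipNr, ip0r).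

Lemma ip_suml (I : finType) (f : I -> V) z :
  ip (\sum_i f i) z = \sum_i ip (f i) z.
Proof. by apply: (big_morph (ip^~ z)) => [x y|]; rewrite ?ipDl ?ip0l. Qed.

Lemma ip_ext x y : (forall z, ip x z = ip y z) -> x = y.
Proof.
move=> eq_ip; apply/eqP; rewrite -subr_eq0; apply/eqP/ip_eq0.
by rewrite ipDl ipNl eq_ip subrr.
Qed.

Lemma ip_gt0 x : x <> 0 -> 0 < ip x x.
Proof. by move=> x_neq0; rewrite lt_def ip_ge0 andbT; apply/eqP => /ip_eq0. Qed.

Lemma ip_neq0 x : x <> 0 -> ip x x != 0.
Proof. by move/ip_gt0; rewrite lt0r => /andP[]. Qed.

Lemma ip_perpC x y : ip x y = 0 -> ip y x = 0.
Proof. by move=> xy0; rewrite ipC xy0 rmorph0. Qed.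

Lemma norm_ip x : `|ip x x| = ip x x.
Proof. exact/normr_idP/ip_ge0. Qed.

(** * Projections *)

Lemma is_projectionI (P : V -> V) : (forall x y, ip (P x) y = ip x (P y)) ->
  (forall x, P (P x) = P x) -> is_projection ip P.
Proof.
move=> PC PK; split => // [a x y|].
  by apply: ip_ext => z; rewrite PC !ipE !PC.
exists 1 => x; rewrite mul1r !norm_ip -subr_ge0.
have -> : ip x x - ip (P x) (P x) = ip (x - P x) (x - P x).
  by rewrite !ipE -!PC PK; ring.
exact: ip_ge0.
Qed.

Record projection := Projection {
  proj_fun :> V -> V;
  proj_is_projection : is_projection ip proj_fun
}.

Implicit Types P Q A B C D : projection.

Lemma proj_semilinear P : Defs.semilinear idfun P.
Proof. by case: P => P []. Qed.

Lemma projD P x y : P (x + y) = P x + P y.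
Proof. exact: (semilinearD (proj_semilinear P)). Qed.

Lemma projZ P a x : P (a *: x) = a *: P x.
Proof. exact: (semilinearZ (proj_semilinear P)). Qed.

Lemma proj0 P : P 0 = 0.
Proof. exact: (semilinear0 (proj_semilinear P)). Qed.

Lemma projB P x y : P (x - y) = P x - P y.
Proof. exact: (semilinearB (proj_semilinear P)). Qed.

Lemma projK P x : P (P x) = P x.
Proof. by case: P => P []. Qed.

Lemma projC P x y : ip (P x) y = ip x (P y).
Proof. by case: P => P []. Qed.

Lemma proj_ext P Q : P =1 Q -> P = Q.
Proof.
case: P Q => P projP [Q projQ] /funext /= eqPQ; case: _ / eqPQ projQ => projQ.
by rewrite (Prop_irrelevance projP projQ).
Qed.

Lemma ip_projxx P x : ip (P x) x = ip (P x) (P x).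
Proof. by rewrite -projC projK. Qed.

Lemma proj_pythagoras P x : ip x x = ip (P x) (P x) + ip (x - P x) (x - P x).
Proof. by rewrite !ipE -(projC P x x) -!ip_projxx; ring. Qed.

Lemma proj_fix P x : ip (P x) x = ip x x -> P x = x.
Proof.
rewrite ip_projxx => eq_ip; apply/esym/eqP; rewrite -subr_eq0; apply/eqP/ip_eq0.
by apply: (addrI (ip (P x) (P x))); rewrite -proj_pythagoras addr0.
Qed.

Definition compl_fun P x : V := x - P x.

Lemma is_projection_compl P : is_projection ip (compl_fun P).
Proof.
apply: is_projectionI => [x y|x]; rewrite /compl_fun.
  by rewrite !ipE projC.
by rewrite projB projK subrr subr0.
Qed.

Definition compl P : projection := Projection (is_projection_compl P).

Lemma complE P x : compl P x = x - P x.
Proof. by []. Qed.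

Lemma complK : involutive compl.
Proof. by move=> P; apply: proj_ext => x; rewrite !complE subKr. Qed.

Lemma compl_fix P x : P x = 0 -> compl P x = x.
Proof. by rewrite complE => ->; rewrite subr0. Qed.

Lemma compl_perp P x : P x = x -> compl P x = 0.
Proof. by rewrite complE => ->; rewrite subrr. Qed.

Lemma compl_eq0 P x : compl P x = 0 -> P x = x.
Proof. by move/compl_fix; rewrite complK. Qed.

Definition line_fun x u : V := (ip u x / ip x x) *: x.

Lemma is_projection_line x : is_projection ip (line_fun x).
Proof.
apply: is_projectionI => [u v|u]; rewrite /line_fun.
  rewrite !ipE rmorphM fmorphV /= -!ipC.
  by rewrite mulrAC [RHS]mulrAC (mulrC (ip u x)).
have [->|/eqP x_neq0] := eqVneq x 0; first by rewrite !scaler0.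
by rewrite ipZl divfK ?ip_neq0.
Qed.

Definition line_proj x : projection := Projection (is_projection_line x).

Lemma line_projE x u : line_proj x u = (ip u x / ip x x) *: x.
Proof. by []. Qed.

Lemma line_proj_id x : line_proj x x = x.
Proof.
have [->|/eqP x_neq0] := eqVneq x 0; first by rewrite line_projE scaler0.
by rewrite line_projE divff ?scale1r ?ip_neq0.
Qed.

Lemma norm_line_proj x u :
  ip (line_proj x u) (line_proj x u) = `|ip u x| ^+ 2 / ip x x.
Proof. by rewrite -ip_projxx line_projE ipZl (ipC u) -mul_cj mulrAC. Qed.

Lemma line_projZ c v : c != 0 -> line_proj (c *: v) = line_proj v.
Proof.
move=> c_neq0; apply: proj_ext => u; rewrite !line_projE !ipE scalerA.
have [->|/eqP v_neq0] := eqVneq v 0; first by rewrite !scaler0.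
congr (_ *: _); field; rewrite c_neq0 (ip_neq0 v_neq0) andbT /=.
by rewrite fmorph_eq0.
Qed.

Lemma line_proj_compress x y u : line_proj x (line_proj y (line_proj x u)) =
  (`|ip x y| ^+ 2 / (ip x x * ip y y)) *: line_proj x u.
Proof.
rewrite !line_projE !ipE !scalerA; congr (_ *: _).
by rewrite -mul_cj (ipC x y) invfM; ring.
Qed.

Lemma proj_scale_eq_or_eq0 P Q c d : (forall u, c *: P u = d *: Q u) ->
  (exists u, P u <> 0) -> c = d \/ c = 0.
Proof.
move=> eq_cPdQ [u Pu_neq0]; have [->|cd_neq0] := eqVneq c d; first by left.
have cPu : c *: P u = d *: Q (P u) by rewrite -eq_cPdQ projK.
have : (c - d) *: Q (P u) = 0.
  by rewrite scalerBl -projZ cPu projZ projK subrr.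
move/eqP; rewrite scaler_eq0 subr_eq0 (negPf cd_neq0) => /eqP QPu0.
by right; move/eqP: cPu; rewrite QPu0 scaler0 scaler_eq0 => /orP[/eqP|/eqP].
Qed.

Lemma proj_scale_inj P Q c d : (forall u, c *: P u = d *: Q u) ->
  (exists u, P u <> 0) -> (exists u, Q u <> 0) -> c = d.
Proof.
move=> eq_cPdQ P_neq0 Q_neq0.
have [//|c0] := proj_scale_eq_or_eq0 eq_cPdQ P_neq0.
by have [->//|->] := proj_scale_eq_or_eq0 (fun u => esym (eq_cPdQ u)) Q_neq0.
Qed.

Lemma cauchy_schwarz x y : `|ip x y| ^+ 2 <= ip x x * ip y y.
Proof.
have [->|/eqP y_neq0] := eqVneq y 0; first by rewrite !ip0r normr0 expr0n mulr0.
rewrite -ler_pdivrMr ?ip_gt0 // -norm_line_proj.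
by rewrite (proj_pythagoras (line_proj y) x) lerDl ip_ge0.
Qed.

Lemma cauchy_schwarz_eq x y : y <> 0 ->
  `|ip x y| ^+ 2 = ip x x * ip y y -> line_proj y x = x.
Proof.
move=> y_neq0 eq_norm; apply: proj_fix.
by rewrite ip_projxx norm_line_proj eq_norm mulfK ?ip_neq0.
Qed.

Definition same_ray u v : Prop := exists2 c, `|c| = 1 & u = c *: v.

Lemma same_ray_refl u : same_ray u u.
Proof. by exists 1; rewrite ?normr1 ?scale1r. Qed.

Lemma same_ray_norm_ip u u' v v' : same_ray u u' -> same_ray v v' ->
  `|ip u v| = `|ip u' v'|.
Proof.
by move=> [c c1 ->] [d d1 ->]; rewrite !ipE !normrM norm_cj // c1 d1 !mul1r.
Qed.

Lemma same_rayI u v : ip u u = ip v v -> `|ip u v| = ip v v -> same_ray u v.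
Proof.
move=> eq_ip norm_uv; have [v0|/eqP v_neq0] := eqVneq v 0.
  exists 1; first exact: normr1.
  by rewrite scale1r v0; apply: ip_eq0; rewrite eq_ip v0 ip0l.
exists (ip u v / ip v v).
  by rewrite normrM normfV norm_uv norm_ip divff ?ip_neq0.
by rewrite -line_projE cauchy_schwarz_eq // norm_uv eq_ip expr2.
Qed.

Lemma line_proj_same_ray u v : same_ray u v -> line_proj u = line_proj v.
Proof. by move=> [c c1 ->]; rewrite line_projZ // -normr_eq0 c1 oner_eq0. Qed.

Definition proj_orth P Q : Prop := forall x, P (Q x) = 0.
Definition proj_le P Q : Prop := forall x, Q (P x) = P x.

Lemma proj_orthC P Q : proj_orth P Q -> proj_orth Q P.
Proof. by move=> PQ x; apply: ip_ext => z; rewrite !projC PQ ip0r ip0l. Qed.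

Lemma proj_orth_line P x : P x = 0 -> proj_orth P (line_proj x).
Proof. by move=> Px u; rewrite line_projE projZ Px scaler0. Qed.

Lemma proj_le_comp P Q : proj_le P Q -> forall x, P (Q x) = P x.
Proof. by move=> le_PQ x; apply: ip_ext => z; rewrite !projC le_PQ. Qed.

Lemma proj_le_perp P Q x : proj_le P Q -> Q x = 0 -> P x = 0.
Proof. by move=> le_PQ Qx; rewrite -(proj_le_comp le_PQ) Qx proj0. Qed.

Lemma proj_le_anti P Q : proj_le P Q -> proj_le Q P -> P = Q.
Proof.
move=> le_PQ le_QP; apply: proj_ext => x.
by rewrite -(proj_le_comp le_PQ) le_QP.
Qed.

Lemma proj_orth_le P Q Q' : proj_le Q' Q -> proj_orth P Q -> proj_orth P Q'.
Proof. by move=> le_Q'Q PQ x; rewrite -le_Q'Q PQ. Qed.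

Lemma proj_orth_compl P : proj_orth (compl P) P.
Proof. by move=> x; rewrite compl_perp ?projK. Qed.

Lemma proj_le_complP P Q : proj_le Q (compl P) <-> proj_orth P Q.
Proof.
split=> [le_QP x|PQ x]; last by rewrite compl_fix.
by rewrite -[P _](subKr (Q x)) -complE le_QP subrr.
Qed.

Lemma proj_le_orthP P Q : proj_le P Q <-> proj_orth (compl Q) P.
Proof. by rewrite -proj_le_complP complK. Qed.

(* Replacing [x] by its component orthogonal to [A] makes this a projection for
   every [x]. *)
Definition adjoin_fun A x u : V := A u + line_proj (compl A x) u.

Lemma proj_orth_adjoined_line A x : proj_orth A (line_proj (compl A x)).
Proof. by apply: proj_orth_line; rewrite complE projB projK subrr. Qed.

Lemma is_projection_adjoin A x : is_projection ip (adjoin_fun A x).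
Proof.
have A_line := proj_orth_adjoined_line A x; have line_A := proj_orthC A_line.
apply: is_projectionI => [u v|u]; rewrite /adjoin_fun.
  by rewrite ipDl ipDr !projC.
by rewrite !projD A_line line_A !projK addr0 add0r.
Qed.

Definition adjoin A x : projection := Projection (is_projection_adjoin A x).

Lemma adjoinE A x u : A x = 0 -> adjoin A x u = A u + line_proj x u.
Proof. by move=> Ax; rewrite /= /adjoin_fun compl_fix. Qed.

Lemma le_adjoin A x : proj_le A (adjoin A x).
Proof.
move=> u; rewrite /= /adjoin_fun projK.
by rewrite (proj_orthC (proj_orth_adjoined_line A x)) addr0.
Qed.

Lemma adjoin_id A x : adjoin A x x = x.
Proof.
rewrite -[X in adjoin A x X](subrK (A x)) projD le_adjoin -complE.
by rewrite /= /adjoin_fun line_proj_id complE projB projK subrr add0r subrK.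
Qed.

Lemma adjoin_orth P A x : proj_orth P A -> P x = 0 -> proj_orth P (adjoin A x).
Proof.
move=> PA Px u; rewrite /= /adjoin_fun projD PA add0r proj_orth_line //.
by rewrite complE projB Px PA subrr.
Qed.

Lemma adjoin_le A x P : proj_le A P -> P x = x -> proj_le (adjoin A x) P.
Proof.
by move=> /proj_le_orthP PA Px; apply/proj_le_orthP/adjoin_orth/compl_perp.
Qed.

Lemma compress_adjoin A B x y u :
  proj_orth A B -> A x = 0 -> A y = 0 -> B x = 0 -> B y = 0 ->
  adjoin A x (adjoin B y (adjoin A x u)) =
    (`|ip x y| ^+ 2 / (ip x x * ip y y)) *: line_proj x u.
Proof.
move=> AB Ax Ay Bx By; rewrite -line_proj_compress.
have -> : adjoin B y (adjoin A x u) = line_proj y (line_proj x u).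
  rewrite !adjoinE // !projD (proj_orthC AB) (proj_orth_line Bx).
  by rewrite (proj_orthC (proj_orth_line Ay)) !add0r.
by rewrite adjoinE // (proj_orth_line Ay) add0r.
Qed.

(** * Existence of projections *)

Definition ip_cvg (u : nat -> V) l : Prop := forall e, 0 < e ->
  exists N, forall n, (N <= n)%N -> ip (u n - l) (u n - l) < e.

Lemma ip_cvg_eq0 (u : nat -> V) l m : ip_cvg u l ->
  (forall e, 0 < e ->
    exists N, forall n, (N <= n)%N -> `|ip (u n) m| ^+ 2 < e) ->
  ip l m = 0.
Proof.
move=> u_l um_0; apply/eqP; rewrite -normr_eq0 -sqrf_eq0; apply/eqP.
have b_ge0 : 0 <= 2 * ip m m + 2 by rewrite addr_ge0 ?mulr_ge0 ?ip_ge0.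
apply: eq0_le_scaled b_ge0 _ => [|e e_gt0]; first exact: exprn_ge0.
have [N lim_u] := u_l e e_gt0; have [N' lim_um] := um_0 e e_gt0.
have {}lim_u := ltW (lim_u _ (leq_maxl N N')).
have {}lim_um := ltW (lim_um _ (leq_maxr N N')).
move: (maxn N N') lim_u lim_um => n lim_u lim_um.
have -> : ip l m = - ip (u n - l) m + ip (u n) m by rewrite !ipE; ring.
apply: le_trans (normD_sqr_le _ _) _; rewrite normrN [leRHS]mulrDl.
apply: lerD; last by rewrite ler_pM2l ?ltr0n.
rewrite -mulrA ler_pM2l ?ltr0n //; apply: le_trans (cauchy_schwarz _ _) _.
by rewrite mulrC ler_wpM2l ?ip_ge0.
Qed.

Definition perp S y : Prop := forall s, S s -> ip y s = 0.

Definition closed_subspace S : Prop := subspace S /\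
  forall (u : nat -> V) l, (forall n, S (u n)) -> ip_cvg u l -> S l.

Lemma closed_subspace_perp S : closed_subspace (perp S).
Proof.
split; first split=> [s _|a x y Sx Sy s Ss]; first exact: ip0l.
  by rewrite ip_lin Sx // Sy // mulr0 addr0.
move=> u l Su u_l s Ss; apply: ip_cvg_eq0 u_l _ => e e_gt0.
by exists 0%N => n _; rewrite Su // normr0 expr0n.
Qed.

Lemma ip_apollonius x y z :
  ip (y - z) (y - z) = 2 * (ip (x - y) (x - y) + ip (x - z) (x - z)
    - 2 * ip (x - 2^-1 *: (y + z)) (x - 2^-1 *: (y + z))).
Proof.
have two_neq0 : (2 : K) != 0 by rewrite pnatr_eq0.
by rewrite !ipE rmorphV ?unitfE // rmorph_nat; field.
Qed.

Hypothesis K_inf : inf_complete K.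
Hypothesis V_complete : ip_complete ip.

Section NearestPoint.
Variables (M : V -> Prop) (x : V).
Hypothesis M_closed : closed_subspace M.
Let M_sub : subspace M := proj1 M_closed.

Let dist y : K := ip (x - y) (x - y).

Lemma exists_minimizing_sequence : exists d (y : nat -> V),
  [/\ forall m, M m -> d <= dist m, forall n, M (y n) &
      forall n, dist (y n) < d + n.+1%:R^-1].
Proof.
have [||d [d_le d_approx]] := K_inf (S := fun a => exists2 m, M m & a = dist m).
- by exists (dist 0), 0 => //; exact: (proj1 M_sub).
- by move=> _ [m _ ->]; exact: ip_ge0.
have /choice[y yP] n : exists m, M m /\ dist m < d + n.+1%:R^-1.
  have [|_ [m Mm ->] lt_m] := d_approx n.+1%:R^-1; first by rewrite invr_gt0.
  by exists m.
exists d, y; split=> [m Mm|n|n].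
- by apply: d_le; exists m.
- by case: (yP n).
- by case: (yP n).
Qed.

Section MinimizingSequence.
Variables (d : K) (y : nat -> V).
Hypothesis d_le : forall m, M m -> d <= dist m.
Hypothesis My : forall n, M (y n).
Hypothesis dist_y : forall n, dist (y n) < d + n.+1%:R^-1.

Lemma minimizing_sequence_perp n m : M m ->
  `|ip (x - y n) m| ^+ 2 <= n.+1%:R^-1 * ip m m.
Proof.
move=> Mm; have [->|/eqP m_neq0] := eqVneq m 0.
  by rewrite !ip0r normr0 expr0n mulr0.
have d_le_next : d <= dist (y n + line_proj m (x - y n)).
  by apply: d_le; apply: subspaceD => //; exact: subspaceZ.
have dist_split := proj_pythagoras (line_proj m) (x - y n).
rewrite norm_line_proj -addrA -opprD in dist_split.
rewrite -ler_pdivrMr ?ip_gt0 // -(lerD2r d) [leRHS]addrC.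
by apply: le_trans (ltW (dist_y n)); rewrite /dist dist_split lerD2l.
Qed.

Lemma minimizing_sequence_cauchy m n :
  ip (y m - y n) (y m - y n) <= 2 * (m.+1%:R^-1 + n.+1%:R^-1).
Proof.
rewrite (ip_apollonius x) ler_pM2l ?ltr0n // lerBlDr.
have d_mid : d <= dist (2^-1 *: (y m + y n)).
  by apply: d_le; apply: subspaceZ => //; exact: subspaceD.
apply: le_trans (lerD (ltW (dist_y m)) (ltW (dist_y n))) _.
by rewrite addrACA addrC lerD2l -mulr2n -[leLHS]mulr_natl ler_pM2l ?ltr0n.
Qed.

Lemma minimizing_sequence_cvg : exists l, ip_cvg y l.
Proof.
have [e e_gt0|l y_l] := V_complete (u := y); last first.
  by exists l => e /y_l[N N_lt]; exists N => n /N_lt; rewrite norm_ip.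
have [|N N_lt] := invn_eventually_lt K_inf (e := e / 4); first exact: divr_gt0.
exists N => m n le_Nm le_Nn; rewrite norm_ip.
apply: le_lt_trans (minimizing_sequence_cauchy m n) _.
have -> : e = 2 * (e / 4 + e / 4) by field.
by rewrite ltr_pM2l ?ltr0n // ltrD ?N_lt.
Qed.

Lemma minimizing_sequence_limit_perp l m : ip_cvg y l -> M m ->
  ip (x - l) m = 0.
Proof.
move=> y_l Mm; apply: (@ip_cvg_eq0 (fun n => x - y n)) => e e_gt0.
  have [N N_lt] := y_l e e_gt0; exists N => n /N_lt.
  suff -> : x - y n - (x - l) = - (y n - l) by rewrite ipNl ipNr opprK.
  by rewrite !opprB addrC addrA subrK.
have b_gt0 : 0 < ip m m + 1 by rewrite ltr_wpDl ?ip_ge0.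
have [|N N_lt] := invn_eventually_lt K_inf (e := e / (ip m m + 1)).
  exact: divr_gt0.
exists N => n /N_lt n_lt; apply: le_lt_trans (minimizing_sequence_perp n Mm) _.
apply: (@le_lt_trans _ _ (n.+1%:R^-1 * (ip m m + 1))).
  by rewrite ler_wpM2l ?invr_ge0 // lerDl.
by rewrite -ltr_pdivlMr.
Qed.

End MinimizingSequence.

Lemma exists_nearest_point : exists l, M l /\ perp M (x - l).
Proof.
have [d [y [d_le My dist_y]]] := exists_minimizing_sequence.
have [l y_l] := minimizing_sequence_cvg d_le My dist_y; exists l.
split=> [|m Mm]; first exact: (proj2 M_closed) My y_l.
exact: minimizing_sequence_limit_perp d_le My dist_y _ _ y_l Mm.
Qed.

End NearestPoint.

Lemma exists_proj_onto M : closed_subspace M ->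
  exists P, forall x, M (P x) /\ perp M (compl P x).
Proof.
move=> M_closed; have /choice[f fP] x := exists_nearest_point x M_closed.
have f_perp x y : ip (f x) (y - f y) = 0.
  by apply: ip_perpC; apply: (proj2 (fP y)); exact: (proj1 (fP x)).
have f_ip x y : ip (f x) (f y) = ip (f x) y.
  by apply/esym/eqP; rewrite -subr_eq0 -ipNr -ipDr f_perp.
have f_proj : is_projection ip f.
  apply: is_projectionI => [x y|x]; first by rewrite -f_ip ipC f_ip -ipC.
  apply/esym/eqP; rewrite -subr_eq0; apply/eqP/ip_eq0.
  by rewrite ipDl ipNl !f_perp subr0.
by exists (Projection f_proj).
Qed.

Lemma exists_proj_span S :
  exists P, (forall s, S s -> P s = s) /\ forall y, perp S y -> P y = 0.
Proof.
have [P PS] := exists_proj_onto (closed_subspace_perp S); exists (compl P).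
split=> [s Ss|y Sy].
  by apply: compl_fix; apply: ip_eq0; rewrite -ip_projxx (proj1 (PS s)).
by apply: ip_eq0; rewrite -ip_projxx (proj2 (PS y)).
Qed.

(** * Infinite rank *)

Definition proj_range P x : Prop := P x = x.
Definition inf_rank P : Prop := infinite_dimensional (proj_range P).

Lemma proj_infP P : proj_inf ip P <-> inf_rank P.
Proof.
split=> [[_]|P_inf].
  by apply: infinite_dimensional_sub => _ [y <-]; exact: projK.
split; first exact: proj_is_projection.
by apply: infinite_dimensional_sub P_inf => x Px; exists x.
Qed.

Lemma subspace_range P : subspace (proj_range P).
Proof.
split=> [|a x y Px Py]; first exact: proj0.
by rewrite /proj_range projD projZ Px Py.
Qed.

Lemma infinite_dimensional_perp S (l : seq V) :
  subspace S -> infinite_dimensional S ->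
  exists z, [/\ S z, z <> 0 & forall y, y \in l -> ip z y = 0].
Proof.
move=> S_sub S_inf; have [e [Se e_indep]] := S_inf (size l).+1.
pose gram := \matrix_(i < (size l).+1, j < size l) ip (e i) l`_j.
have : kermx gram != 0.
  by rewrite -mxrank_eq0 mxrank_ker subn_eq0 -ltnNge ltnS rank_leq_col.
case/rowV0Pn => c /sub_kermxP c_gram c_neq0.
exists (\sum_i c 0 i *: e i); split.
- exact: subspace_sum.
- move=> /e_indep c0; case/eqP: c_neq0; apply/rowP => i; rewrite mxE; exact: c0.
- move=> y l_y; have lt_yl : (index y l < size l)%N by rewrite index_mem.
  move/matrixP/(_ 0 (Ordinal lt_yl)): c_gram; rewrite !mxE => c_gram.
  rewrite ip_suml -[RHS]c_gram; apply: eq_bigr => i _.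
  by rewrite ipZl mxE /= nth_index.
Qed.

Definition orthogonal_family (z : nat -> V) : Prop :=
  (forall n, z n <> 0) /\ forall m n, m <> n -> ip (z m) (z n) = 0.

Lemma orthogonal_family_comp (z : nat -> V) (f : nat -> nat) : injective f ->
  orthogonal_family z -> orthogonal_family (z \o f).
Proof.
move=> f_inj [z_neq0 z_perp]; split=> [n|m n neq_mn]; first exact: z_neq0.
by apply: z_perp => /f_inj.
Qed.

Lemma exists_orthogonal_family (S : nat -> V -> Prop) (l : seq V) :
  (forall n, subspace (S n)) -> (forall n, infinite_dimensional (S n)) ->
  exists z : nat -> V, [/\ orthogonal_family z, forall n, S n (z n) &
    forall n y, y \in l -> ip (z n) y = 0].
Proof.
move=> S_sub S_inf.
have /choice[next nextP] (p : nat * seq V) :=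
  infinite_dimensional_perp p.2 (S_sub p.1) (S_inf p.1).
pose prefix := fix prefix n :=
  if n is m.+1 then next (m, prefix m) :: prefix m else l.
pose z n := next (n, prefix n).
have l_prefix n y : y \in l -> y \in prefix n.
  by elim: n => //= n IHn /IHn; rewrite inE orbC => ->.
have z_prefix m n : (m < n)%N -> z m \in prefix n.
  elim: n => //= n IHn; rewrite ltnS leq_eqVlt inE => /orP[/eqP->|/IHn->].
    by rewrite eqxx.
  by rewrite orbT.
have z_perp n y : y \in prefix n -> ip (z n) y = 0.
  by case: (nextP (n, prefix n)) => _ _; apply.
exists z; split=> [|n|n y /(l_prefix n)/z_perp//].
- split=> [n|m n /eqP]; first by case: (nextP (n, prefix n)).
  by rewrite neq_ltn => /orP[] /z_prefix/z_perp //; exact: ip_perpC.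
- by case: (nextP (n, prefix n)).
Qed.

Lemma orthogonal_family_infinite S (z : nat -> V) :
  orthogonal_family z -> (forall n, S (z n)) -> infinite_dimensional S.
Proof.
move=> [z_neq0 z_perp] Sz n; exists (fun i : 'I_n => z i); split=> // c sum0 i.
have := congr1 (ip^~ (z i)) sum0; rewrite ip_suml ip0l (bigD1 i) //= big1.
  rewrite addr0 ipZl => /eqP.
  by rewrite mulf_eq0 (negPf (ip_neq0 (z_neq0 i))) orbF => /eqP.
by move=> j neq_ji; rewrite ipZl z_perp ?mulr0 // => /ord_inj/eqP; exact/negP.
Qed.

Lemma inf_rank_le P Q : proj_le P Q -> inf_rank P -> inf_rank Q.
Proof.
move=> le_PQ; apply: infinite_dimensional_sub => x Px.
by rewrite -Px; exact: le_PQ.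
Qed.

Lemma exists_subprojection P (z : nat -> V) :
  orthogonal_family z -> (forall n, P (z n) = z n) ->
  exists C, [/\ inf_rank C, proj_le C P &
    forall y, (forall n, ip y (z n) = 0) -> C y = 0].
Proof.
move=> z_orth Pz.
have [C [Cz C_perp]] := exists_proj_span (fun y => exists n, y = z n).
have {}C_perp y : (forall n, ip y (z n) = 0) -> C y = 0.
  by move=> y_perp; apply: C_perp => _ [n ->].
exists C; split=> //.
  by apply: (orthogonal_family_infinite z_orth) => n; apply: Cz; exists n.
apply/proj_le_orthP/proj_orthC => y; apply: C_perp => n.
by rewrite projC compl_perp ?ip0r.
Qed.

Lemma exists_orthogonal_subprojections P Q (l : seq V) :
  inf_rank P -> inf_rank Q -> exists C D, [/\ inf_rank C /\ inf_rank D,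
    proj_le C P, proj_le D Q, proj_orth C D &
    forall y, y \in l -> C y = 0 /\ D y = 0].
Proof.
move=> P_inf Q_inf; pose R n := if odd n then P else Q.
have [|n|z [z_orth Rz z_l]] :=
  @exists_orthogonal_family (fun n => proj_range (R n)) l.
- by move=> n; exact: subspace_range.
- by rewrite /R; case: odd.
have z_odd_even m n : ip (z m.*2.+1) (z n.*2) = 0.
  by apply: (proj2 z_orth) => /(congr1 odd); rewrite /= !odd_double.
have odd_inj : injective (fun n => n.*2.+1) by move=> m n [/double_inj].
have [|C [C_inf le_CP C_perp]] := @exists_subprojection P _
    (orthogonal_family_comp odd_inj z_orth).
  by move=> n; have := Rz n.*2.+1; rewrite /R /= odd_double.
have [|D [D_inf le_DQ D_perp]] := @exists_subprojection Q _
    (orthogonal_family_comp double_inj z_orth).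
  by move=> n; have := Rz n.*2; rewrite /R odd_double.
exists C, D; split=> // [x|y l_y].
  apply: C_perp => m; rewrite projC D_perp ?ip0r // => n; exact: z_odd_even.
by split; [apply: C_perp | apply: D_perp] => n; exact/ip_perpC/z_l.
Qed.

(* Orthogonality among projections of infinite rank determines the order only
   below a projection that also has infinite corank. *)
Definition bi_infinite P : Prop := inf_rank P /\ inf_rank (compl P).

Lemma bi_infinite_compl P : bi_infinite P -> bi_infinite (compl P).
Proof. by case=> P_inf P_coinf; split; rewrite ?complK. Qed.

Lemma proj_orth_bi_infinite P Q :
  inf_rank P -> inf_rank Q -> proj_orth P Q -> bi_infinite P.
Proof.
move=> P_inf Q_inf /proj_le_complP le_QP; split=> //.
exact: inf_rank_le Q_inf.
Qed.

Lemma bi_infinite_adjoin A x : bi_infinite A -> bi_infinite (adjoin A x).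
Proof.
case=> A_inf A_coinf; have [C [D [[C_inf _] le_CA _ _ CD_perp]]] :=
  exists_orthogonal_subprojections [:: compl A x] A_coinf A_coinf.
apply: (proj_orth_bi_infinite (Q := C)) => //.
  exact: inf_rank_le (le_adjoin A x) A_inf.
apply/proj_orthC/adjoin_orth.
  by apply/proj_orthC/proj_le_complP.
by rewrite -(proj_le_comp le_CA); case: (CD_perp _ (mem_head _ _)).
Qed.

Lemma proj_le_inf_rankP P Q : bi_infinite Q ->
  proj_le P Q <-> forall Z, inf_rank Z -> proj_orth Z Q -> proj_orth Z P.
Proof.
case=> _ Q_coinf; split=> [le_PQ Z _|]; first exact: proj_orth_le.
by move=> /(_ _ Q_coinf (proj_orth_compl Q)) /proj_le_orthP.
Qed.

Lemma exists_orthogonal_bi_infinite (l : seq V) :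
  infinite_dimensional (fun _ : V => True) ->
  exists A A', [/\ bi_infinite A, bi_infinite A', proj_orth A A' &
    forall y, y \in l -> A y = 0 /\ A' y = 0].
Proof.
move=> V_inf; have id_proj : is_projection ip id by exact: is_projectionI.
have id_inf : inf_rank (Projection id_proj).
  exact: infinite_dimensional_sub V_inf.
have [A [A' [[A_inf A'_inf] _ _ AA' A_l]]] :=
  exists_orthogonal_subprojections l id_inf id_inf.
exists A, A'; split=> //; first exact: proj_orth_bi_infinite AA'.
exact: proj_orth_bi_infinite (proj_orthC AA').
Qed.

(** * Wigner's theorem *)

Section TracePreserving.
Variables (M : V -> Prop) (G : V -> V).
Hypothesis M_sub : subspace M.
Hypothesis trace_G : forall x y, M x -> M y ->
  cj_trace cj (ip (G x) (G y)) = cj_trace cj (ip x y).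
Hypothesis norm_G : forall x y, M x -> M y -> `|ip (G x) (G y)| = `|ip x y|.

Lemma trace_preserving_ip x : M x -> ip (G x) (G x) = ip x x.
Proof. by move=> Mx; rewrite -[LHS]norm_ip norm_G ?norm_ip. Qed.

Lemma trace_preserving_add x y : M x -> M y -> G (x + y) = G x + G y.
Proof.
move=> Mx My; have Mxy := subspaceD M_sub Mx My.
have trE u v : cj_trace cj (ip u v) = ip u v + ip v u by rewrite /cj_trace -ipC.
apply/eqP; rewrite -subr_eq0; apply/eqP/ip_eq0.
have -> : ip (G (x + y) - (G x + G y)) (G (x + y) - (G x + G y)) =
    ip (G (x + y)) (G (x + y)) + ip (G x) (G x) + ip (G y) (G y)
    + cj_trace cj (ip (G x) (G y)) - cj_trace cj (ip (G (x + y)) (G x))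
    - cj_trace cj (ip (G (x + y)) (G y)) by rewrite !trE !ipE; ring.
by rewrite !trace_G // !trace_preserving_ip // !trE !ipE; ring.
Qed.

Lemma trace_preserving_scale a x : M x ->
  G (a *: x) = a *: G x \/ G (a *: x) = cj a *: G x.
Proof.
move=> Mx; have Max := subspaceZ a M_sub Mx.
have [x0|/eqP x_neq0] := eqVneq x 0.
  left; rewrite x0 scaler0; suff -> : G 0 = 0 by rewrite scaler0.
  by apply: ip_eq0; rewrite trace_preserving_ip ?ip0l //; exact: (proj1 M_sub).
have Gx_neq0 : G x <> 0.
  by move=> Gx0; apply/x_neq0/ip_eq0; rewrite -trace_preserving_ip // Gx0 ip0l.
have <- : line_proj (G x) (G (a *: x)) = G (a *: x).
  apply: cauchy_schwarz_eq => //.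
  rewrite norm_G // !trace_preserving_ip // ipZl normrM norm_ip.
  by rewrite exprMn -mul_cj !ipE; ring.
rewrite line_projE trace_preserving_ip //.
have eq_tr := esym (trace_G Max Mx); have eq_norm := esym (norm_G Max Mx).
have [->|->] := cj_trace_norm_eq mul_cj eq_tr eq_norm.
  by left; rewrite ipZl mulfK ?ip_neq0.
by right; rewrite ipZl rmorphM /= -ipC mulfK ?ip_neq0.
Qed.

Lemma trace_preserving_homogeneous_at x : M x ->
  (forall a, G (a *: x) = a *: G x) \/ (forall a, G (a *: x) = cj a *: G x).
Proof.
move=> Mx; have MZ a := subspaceZ a M_sub Mx.
have GB a b : G ((a - b) *: x) = G (a *: x) - G (b *: x).
  apply: (addIr (G (b *: x))).
  by rewrite subrK -trace_preserving_add // -scalerDl subrK.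
have [||||linear_x|antilinear_x] := @two_subgroup_cover K (fun=> True)
    (fun a => G (a *: x) = a *: G x) (fun a => G (a *: x) = cj a *: G x).
- by [].
- by move=> a b _ _ Ga Gb; rewrite GB Ga Gb scalerBl.
- by move=> a b _ _ Ga Gb; rewrite GB Ga Gb rmorphB scalerBl.
- by move=> a _; exact: trace_preserving_scale.
- by left=> a; exact: linear_x.
- by right=> a; exact: antilinear_x.
Qed.

Lemma trace_preserving_homogeneous : exists2 s : {rmorphism K -> K},
  id_or_cj cj s & forall a x, M x -> G (a *: x) = s a *: G x.
Proof.
have GB x y : M x -> M y -> G (x - y) = G x - G y.
  move=> Mx My; have Mxy := subspaceB M_sub Mx My.
  by apply: (addIr (G y)); rewrite subrK -trace_preserving_add ?subrK.
have [||||linear_G|antilinear_G] := @two_subgroup_cover V M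
    (fun x => forall a, G (a *: x) = a *: G x)
    (fun x => forall a, G (a *: x) = cj a *: G x).
- by move=> x y; exact: subspaceD.
- move=> x y Mx My Gx Gy a.
  by rewrite scalerBr !GB ?Gx ?Gy ?scalerBr //; exact: subspaceZ.
- move=> x y Mx My Gx Gy a.
  by rewrite scalerBr !GB ?Gx ?Gy ?scalerBr //; exact: subspaceZ.
- by move=> x; exact: trace_preserving_homogeneous_at.
- by exists idfun; [left | move=> a x /linear_G].
- by exists cj; [right | move=> a x /antilinear_G].
Qed.

Lemma trace_preserving_ip_semilinear (s : {rmorphism K -> K}) : id_or_cj cj s ->
  (forall a x, M x -> G (a *: x) = s a *: G x) ->
  forall x y, M x -> M y -> ip (G x) (G y) = s (ip x y).
Proof.
move=> s_idcj GZ x y Mx My; set z := ip x y.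
have [z0|z_neq0] := eqVneq z 0.
  by apply/eqP; rewrite z0 rmorph0 -normr_eq0 norm_G // -/z z0 normr0.
have Mzx := subspaceZ (cj z) M_sub Mx.
have zz_ge0 : 0 <= z * cj z by rewrite mul_cj exprn_ge0.
have scjz_neq0 : s (cj z) != 0 by rewrite !fmorph_eq0.
apply: (mulfI scjz_neq0); rewrite -rmorphM [cj z * z]mulrC.
rewrite (id_or_cj_ge0 mul_cj s_idcj zz_ge0) -ipZl -GZ //.
have trace_eq := esym (trace_G Mzx My); have norm_eq := esym (norm_G Mzx My).
rewrite ipZl -/z [cj z * z]mulrC in trace_eq norm_eq.
have [->//|->] := cj_trace_norm_eq mul_cj trace_eq norm_eq.
by rewrite (cj_ge0 mul_cj).
Qed.

End TracePreserving.

Section Wigner.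
Variable T : V -> V.
Hypothesis norm_T : forall x y, `|ip (T x) (T y)| = `|ip x y|.

Lemma transition_preserving_ip x : ip (T x) (T x) = ip x x.
Proof. by rewrite -[LHS]norm_ip norm_T norm_ip. Qed.

Section AffineChart.
Variable e : V.
Hypothesis e_neq0 : e <> 0.

Let k : K := ip e e.
Let k_gt0 : 0 < k. Proof. exact: ip_gt0. Qed.
Let k_neq0 : k != 0. Proof. exact: ip_neq0. Qed.
Let M x : Prop := ip x e = 0.

Let M_sub : subspace M.
Proof.
split=> [|a x y Mx My]; first exact: ip0l.
by rewrite /M ip_lin Mx My mulr0 addr0.
Qed.

(* Normalising [T (e + x)] against [T e] removes the freedom of phase. *)
Lemma exists_tangent_map : exists G, forall x, M x ->
  ip (G x) (T e) = 0 /\ same_ray (T e + G x) (T (e + x)).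
Proof.
have /choice[G GP] x : exists y, M x ->
    ip y (T e) = 0 /\ same_ray (T e + y) (T (e + x)); last by exists G.
pose c := k / ip (T (e + x)) (T e); exists (c *: T (e + x) - T e) => Mx.
have norm_c : `|ip (T (e + x)) (T e)| = k.
  by rewrite norm_T ipDl Mx addr0 norm_ip.
split; last by exists c; rewrite ?subrKC // normrM normfV norm_c norm_ip divff.
rewrite ipDl ipNl ipZl divfK ?transition_preserving_ip ?subrr //.
by rewrite -normr_eq0 norm_c.
Qed.

Variable G : V -> V.
Hypothesis G_perp : forall x, M x -> ip (G x) (T e) = 0.
Hypothesis G_ray : forall x, M x -> same_ray (T e + G x) (T (e + x)).

Let ip_eD x y : M x -> M y -> ip (e + x) (e + y) = k + ip x y.
Proof. by move=> Mx My; rewrite !ipE Mx (ip_perpC My) addr0 add0r. Qed.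

Let norm_k_G x y : M x -> M y -> `|k + ip (G x) (G y)| = `|k + ip x y|.
Proof.
move=> Mx My; rewrite -(ip_eD Mx My) -norm_T.
rewrite -(same_ray_norm_ip (G_ray Mx) (G_ray My)) !ipE (G_perp Mx).
by rewrite (ip_perpC (G_perp My)) transition_preserving_ip addr0 add0r.
Qed.

Let ip_G x : M x -> ip (G x) (G x) = ip x x.
Proof.
move=> Mx; have := norm_k_G Mx Mx.
by rewrite !ger0_norm ?addr_ge0 ?ip_ge0 // => /addrI.
Qed.

Lemma tangent_map_ray x : M x -> same_ray (G x) (T x).
Proof.
move=> Mx; apply: same_rayI; rewrite ?ip_G ?transition_preserving_ip //.
have Te_perp : ip (T e) (T x) = 0.
  by apply/eqP; rewrite -normr_eq0 norm_T (ip_perpC Mx) normr0.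
have := same_ray_norm_ip (G_ray Mx) (same_ray_refl (T x)).
by rewrite norm_T !ipDl Te_perp (ip_perpC Mx) !add0r norm_ip.
Qed.

Let norm_G x y : M x -> M y -> `|ip (G x) (G y)| = `|ip x y|.
Proof.
move=> Mx My.
by rewrite (same_ray_norm_ip (tangent_map_ray Mx) (tangent_map_ray My)).
Qed.

Let trace_G x y : M x -> M y ->
  cj_trace cj (ip (G x) (G y)) = cj_trace cj (ip x y).
Proof.
move=> Mx My; apply: (eq_cj_trace mul_cj k_gt0); first exact: norm_k_G.
exact: norm_G.
Qed.

Lemma tangent_map_homogeneous : exists2 s : {rmorphism K -> K},
  id_or_cj cj s & forall a x, M x -> G (a *: x) = s a *: G x.
Proof. exact: trace_preserving_homogeneous M_sub trace_G norm_G. Qed.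

Variable s : {rmorphism K -> K}.
Hypothesis s_idcj : id_or_cj cj s.
Hypothesis GZ : forall a x, M x -> G (a *: x) = s a *: G x.

Let orthogonal_decomposition x : exists a p, M p /\ x = a *: e + p.
Proof.
exists (ip x e / k), (x - (ip x e / k) *: e); split; last by rewrite subrKC.
by rewrite /M ipDl ipNl ipZl divfK ?subrr.
Qed.

Lemma exists_tangent_extension :
  exists U, forall a p, M p -> U (a *: e + p) = s a *: T e + G p.
Proof.
pose coef x := ip x e / k.
exists (fun x => s (coef x) *: T e + G (x - coef x *: e)) => a p Mp.
have -> : coef (a *: e + p) = a by rewrite /coef ip_lin Mp addr0 mulfK.
by rewrite [_ + p]addrC addrK.
Qed.

Variable U : V -> V.
Hypothesis UE : forall a p, M p -> U (a *: e + p) = s a *: T e + G p.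

Lemma tangent_extension_semilinear : Defs.semilinear s U.
Proof.
move=> c x y; have [a [p [Mp ->]]] := orthogonal_decomposition x.
have [b [q [Mq ->]]] := orthogonal_decomposition y.
have Mcp := subspaceZ c M_sub Mp.
rewrite scalerDr addrACA scalerA -scalerDl !UE //; last exact: subspaceD.
rewrite (trace_preserving_add M_sub trace_G norm_G) // GZ //.
by rewrite rmorphD rmorphM scalerDl -scalerA scalerDr addrACA.
Qed.

Lemma tangent_extension_ip x y : ip (U x) (U y) = s (ip x y).
Proof.
have [a [p [Mp ->]]] := orthogonal_decomposition x.
have [b [q [Mq ->]]] := orthogonal_decomposition y.
have ip_Gpq :=
  trace_preserving_ip_semilinear M_sub trace_G norm_G s_idcj GZ Mp Mq.
rewrite !UE // !ipE (G_perp Mp) (ip_perpC (G_perp Mq)) Mp (ip_perpC Mq).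
rewrite transition_preserving_ip ip_Gpq (cj_id_or_cj _ s_idcj).
rewrite !mulr0 !addr0 !add0r.
by rewrite rmorphD !rmorphM (id_or_cj_ge0 mul_cj s_idcj (ip_ge0 e)).
Qed.

Lemma tangent_extension_ray x : same_ray (U x) (T x).
Proof.
have [a [p [Mp ->]]] := orthogonal_decomposition x.
have [->|a_neq0] := eqVneq a 0.
  have -> : 0 *: e + p = p by rewrite scale0r add0r.
  have -> : U p = G p.
    by rewrite -[p]add0r -(scale0r e) UE // rmorph0 !scale0r !add0r.
  exact: tangent_map_ray.
have Mp' : M (a^-1 *: p) by exact: subspaceZ.
have xE : a *: e + p = a *: (e + a^-1 *: p).
  by rewrite scalerDr scalerA divff // scale1r.
apply: same_rayI; rewrite transition_preserving_ip.
  by rewrite tangent_extension_ip (id_or_cj_ge0 mul_cj s_idcj (ip_ge0 _)).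
have -> : U (a *: e + p) = s a *: (T e + G (a^-1 *: p)).
  by rewrite UE // scalerDr -GZ // scalerA divff // scale1r.
rewrite ipZl normrM (norm_id_or_cj mul_cj _ s_idcj).
rewrite (same_ray_norm_ip (G_ray Mp') (same_ray_refl _)) norm_T.
by rewrite -normrM -ipZl -xE norm_ip.
Qed.

End AffineChart.

Theorem wigner : exists s : {rmorphism K -> K}, exists U,
  [/\ id_or_cj cj s, Defs.semilinear s U,
      forall x y, ip (U x) (U y) = s (ip x y) &
      forall x, same_ray (U x) (T x)].
Proof.
have [V_trivial|/existsNP[e e_neq0]] := pselect (forall x : V, x = 0).
  exists idfun, id; split=> // [|x]; first by left.
  by exists 1; rewrite ?normr1 // [RHS]V_trivial.
have [G GP] := exists_tangent_map e_neq0.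
have G_perp x (Mx : ip x e = 0) := proj1 (GP x Mx).
have G_ray x (Mx : ip x e = 0) := proj2 (GP x Mx).
have [s s_idcj GZ] := tangent_map_homogeneous e_neq0 G_perp G_ray.
have [U UE] := exists_tangent_extension e_neq0 G s.
exists s, U; split=> //.
- exact: tangent_extension_semilinear UE.
- exact: tangent_extension_ip UE.
- exact: tangent_extension_ray UE.
Qed.

Lemma wigner_onto : (forall v, exists x c, v = c *: T x) ->
  exists s : {rmorphism K -> K}, exists U,
    [/\ id_or_cj cj s, isometric_onto ip s U & forall x, same_ray (U x) (T x)].
Proof.
move=> T_onto; have [s [U [s_idcj U_lin U_ip U_T]]] := wigner.
exists s, U; split=> //; split=> // v; have [x [c ->]] := T_onto v.
have [d d1 Ux] := U_T x; exists (s (c / d) *: x).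
have d_neq0 : d != 0 by rewrite -normr_eq0 d1 oner_eq0.
by rewrite (semilinearZ U_lin) (id_or_cjK mul_cj s_idcj) Ux scalerA divfK.
Qed.

End Wigner.

(** * Angles *)

Section IsometricOnto.
Variables (s : {rmorphism K -> K}) (U : V -> V).
Hypothesis s_idcj : id_or_cj cj s.
Hypothesis U_iso : isometric_onto ip s U.

Lemma isometric_onto_semilinear : Defs.semilinear s U.
Proof. by case: U_iso. Qed.

Lemma isometric_onto_ip x y : ip (U x) (U y) = s (ip x y).
Proof. by case: U_iso. Qed.

Lemma isometric_onto_ipxx x : ip (U x) (U x) = ip x x.
Proof. by rewrite isometric_onto_ip (id_or_cj_ge0 mul_cj s_idcj) ?ip_ge0. Qed.

Lemma isometric_onto_eq0 x : U x = 0 -> x = 0.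
Proof. by move=> Ux; apply: ip_eq0; rewrite -isometric_onto_ipxx Ux ip0l. Qed.

Lemma isometric_onto_infinite S S' : (forall x, S x -> S' (U x)) ->
  infinite_dimensional S -> infinite_dimensional S'.
Proof.
exact: (infinite_dimensional_semilinear isometric_onto_semilinear
  (id_or_cjK mul_cj s_idcj) isometric_onto_eq0).
Qed.

Lemma isometric_onto_bijective : exists2 U', cancel U U' & cancel U' U.
Proof.
have U_lin := isometric_onto_semilinear.
have /choice[U' UK'] : forall y, exists x, U x = y by case: U_iso.
exists U' => // x; apply/eqP; rewrite -subr_eq0; apply/eqP/isometric_onto_eq0.
by rewrite (semilinearB U_lin) UK' subrr.
Qed.

Variable U' : V -> V.
Hypothesis UK : cancel U U'.
Hypothesis UK' : cancel U' U.

Lemma isometric_onto_inv : isometric_onto ip s U'.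
Proof.
have sK := id_or_cjK mul_cj s_idcj.
split=> [a x y|x|x y]; last by rewrite -[LHS]sK -isometric_onto_ip !UK'.
  by apply: (can_inj UK); rewrite isometric_onto_semilinear sK !UK'.
by exists (U x).
Qed.

Lemma isometric_onto_line_proj x u : U (line_proj x (U' u)) = line_proj (U x) u.
Proof.
rewrite !line_projE (semilinearZ isometric_onto_semilinear) rmorphM fmorphV /=.
by rewrite -!isometric_onto_ip UK'.
Qed.

End IsometricOnto.

Section Pullback.
Variables (s : {rmorphism K -> K}) (U U' : V -> V).
Hypothesis s_idcj : id_or_cj cj s.
Hypothesis U_iso : isometric_onto ip s U.
Hypothesis UK : cancel U U'.
Hypothesis UK' : cancel U' U.

Definition pullback_fun P x : V := U' (P (U x)).

Lemma is_projection_pullback P : is_projection ip (pullback_fun P).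
Proof.
apply: is_projectionI => [x y|x]; rewrite /pullback_fun.
  apply: (can_inj (id_or_cjK mul_cj s_idcj)).
  by rewrite -!(isometric_onto_ip U_iso) !UK' projC.
by rewrite UK' projK.
Qed.

Definition pullback P : projection := Projection (is_projection_pullback P).

Lemma pullbackE P x : U (pullback P x) = P (U x).
Proof. exact: UK'. Qed.

Lemma inf_rank_pullback P : inf_rank P -> inf_rank (pullback P).
Proof.
have U'_iso := isometric_onto_inv s_idcj U_iso UK UK'.
apply: (isometric_onto_infinite s_idcj U'_iso) => x Px.
by rewrite /proj_range /= /pullback_fun UK' Px.
Qed.

Lemma inf_corank_pullback P : inf_rank (compl (pullback P)) ->
  inf_rank (compl P).
Proof.
apply: (isometric_onto_infinite s_idcj U_iso) => x cPx; apply: compl_fix.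
have Px : pullback P x = 0 by rewrite -[pullback P]complK; exact: compl_perp.
by rewrite -pullbackE Px (semilinear0 (isometric_onto_semilinear U_iso)).
Qed.

End Pullback.

Definition proj_comm P Q : Prop := forall x, P (Q x) = Q (P x).

Lemma compress_eq0_orth P Q : (forall x, Q (P (Q x)) = 0) -> proj_orth P Q.
Proof.
by move=> QPQ x; apply: ip_eq0; rewrite -ip_projxx -projC QPQ ip0l.
Qed.

Lemma compress_idem_comm P Q :
  (forall x, Q (P (Q (Q (P (Q x))))) = Q (P (Q x))) -> proj_comm P Q.
Proof.
move=> QPQ_idem.
have QPQ x : Q (P (Q x)) = P (Q x).
  by apply: proj_fix; rewrite -!projC !projK -[in RHS]QPQ_idem projK.
by move=> x; rewrite -QPQ; apply: ip_ext => z; rewrite !projC QPQ.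
Qed.

Lemma compress_compl A Q u : proj_le A Q -> Q (compl A (Q u)) = Q u - A u.
Proof.
by move=> le_AQ; rewrite complE projB projK le_AQ (proj_le_comp le_AQ).
Qed.

Lemma same_angle_sym P Q P' Q' : same_angle ip P Q P' Q' ->
  same_angle ip P' Q' P Q.
Proof.
move=> [W [W' [W_unit WK WK' eq_W]]]; exists W', W; split=> //.
  by apply: (isometric_onto_inv (s := idfun) _ W_unit WK WK'); left.
by move=> x; rewrite eq_W !WK.
Qed.

Lemma same_angle_orth P Q P' Q' :
  same_angle ip P Q P' Q' -> proj_orth P Q -> proj_orth P' Q'.
Proof.
move=> [W [W' [[W_lin _ _] _ _ eq_W]]] PQ; apply: compress_eq0_orth => x.
by rewrite eq_W PQ proj0 (semilinear0 (s := idfun) W_lin).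
Qed.

Lemma same_angle_inf_corank P P' : same_angle ip P P P' P' ->
  inf_rank (compl P) -> inf_rank (compl P').
Proof.
move=> [W [W' [W_unit WK WK' eq_W]]].
apply: (@isometric_onto_infinite idfun W) => // [|x Px]; first by left.
have Px0 : P x = 0 by rewrite -[P]complK; exact: compl_perp.
have [W_lin _ _] := W_unit; apply: compl_fix.
rewrite -projK -(projK P' (P' _)) eq_W WK Px0 !proj0.
exact: (semilinear0 (s := idfun) W_lin).
Qed.

Lemma same_angle_le_comm P Q P' Q' :
  same_angle ip P Q P' Q' -> proj_le Q P -> proj_comm P' Q'.
Proof.
move=> [W [W' [_ WK _ eq_W]]] le_QP; apply: compress_idem_comm => x.
by rewrite !eq_W WK !le_QP !projK.
Qed.

Lemma same_angle_adjoin A x A' Q' : A x = 0 -> proj_le A' Q' ->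
  same_angle ip (compl A) (adjoin A x) (compl A') Q' ->
  exists v, [/\ ip v v = ip x x, A' v = 0 & Q' = adjoin A' v].
Proof.
move=> Ax le_A'Q' [W [W' [W_unit WK WK' eq_W]]].
have Q'E u : Q' u - A' u = line_proj (W x) u.
  rewrite -compress_compl // eq_W compress_compl; last exact: le_adjoin.
  rewrite adjoinE // addrC addKr.
  exact: (isometric_onto_line_proj (s := idfun) W_unit WK').
have A'Wx : A' (W x) = 0.
  have := congr1 A' (Q'E (W x)); rewrite line_proj_id projB projK.
  by rewrite (proj_le_comp le_A'Q') subrr.
exists (W x); split=> //; first by case: W_unit.
by apply: proj_ext => u; rewrite adjoinE // -Q'E subrKC.
Qed.

Lemma eigen_of_comm P Q x : inf_rank P -> P x = x ->
  (forall A, bi_infinite A -> proj_le A P -> proj_comm Q A) ->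
  Q x = 0 \/ Q x = x.
Proof.
move=> P_inf Px Q_comm; have [C [D [[C_inf D_inf] le_CP _ CD CD_x]]] :=
  exists_orthogonal_subprojections [:: x] P_inf P_inf.
have [Cx _] := CD_x x (mem_head _ _).
have C_bi : bi_infinite C := proj_orth_bi_infinite C_inf D_inf CD.
have CQx : C (Q x) = 0 by rewrite -(Q_comm C) // Cx proj0.
have : Q x = line_proj x (Q x).
  have := Q_comm _ (bi_infinite_adjoin x C_bi) (adjoin_le le_CP Px) x.
  by rewrite adjoin_id adjoinE // CQx add0r.
rewrite line_projE; move: (_ / _) => c Qx.
have := projK Q x; rewrite {1}Qx projZ => /eqP.
rewrite -subr_eq0 -{2}[Q x]scale1r -scalerBl scaler_eq0 subr_eq0.
by case/orP => /eqP Qx'; [right; rewrite Qx Qx' scale1r | left].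
Qed.

(* By [eigen_of_comm] the range of [P] is the union of its intersections with
   the range and the kernel of [Q]. *)
Lemma proj_le_of_comm P Q : inf_rank P -> ~ inf_rank (compl Q) ->
  (forall A, bi_infinite A -> proj_le A P -> proj_comm Q A) -> proj_le P Q.
Proof.
move=> P_inf Q_ncoinf Q_comm.
have [||||fixP|killP] := @two_subgroup_cover V (proj_range P)
    (fun x => Q x = x) (fun x => Q x = 0).
- by move=> x y; apply: subspaceD; exact: subspace_range.
- by move=> x y _ _ Qx Qy; rewrite projB Qx Qy.
- by move=> x y _ _ Qx Qy; rewrite projB Qx Qy subr0.
- by move=> x Px; have [] := eigen_of_comm P_inf Px Q_comm; [right | left].
- by move=> x; apply: fixP; exact: projK.
case: Q_ncoinf; apply: inf_rank_le P_inf; apply/proj_le_complP => x.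
by apply: killP; exact: projK.
Qed.

(** * Maps preserving angles *)

Section AnglePreserving.
Variable phi : projection -> projection.
Hypothesis V_inf : infinite_dimensional (fun _ : V => True).
Hypothesis phi_inf : forall P, inf_rank P -> inf_rank (phi P).
Hypothesis phi_onto : forall Q, inf_rank Q -> exists2 P, inf_rank P & phi P = Q.
Hypothesis phi_angle : forall P Q, inf_rank P -> inf_rank Q ->
  same_angle ip P Q (phi P) (phi Q).

Lemma phi_orth P Q : inf_rank P -> inf_rank Q ->
  proj_orth (phi P) (phi Q) <-> proj_orth P Q.
Proof.
move=> P_inf Q_inf; have PQ_angle := phi_angle P_inf Q_inf.
by split; apply: same_angle_orth; first exact: same_angle_sym.
Qed.

Lemma phi_inf_corank P : inf_rank P ->
  inf_rank (compl (phi P)) <-> inf_rank (compl P).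
Proof.
move=> P_inf; have PP_angle := phi_angle P_inf P_inf.
by split; apply: same_angle_inf_corank; first exact: same_angle_sym.
Qed.

Lemma phi_bi_infinite P : bi_infinite P -> bi_infinite (phi P).
Proof.
by case=> P_inf P_coinf; split; [exact: phi_inf | exact/phi_inf_corank].
Qed.

Lemma phi_onto_bi_infinite Q : bi_infinite Q ->
  exists2 P, bi_infinite P & phi P = Q.
Proof.
case=> /phi_onto[P P_inf <-] phiP_coinf; exists P => //.
by split=> //; apply/phi_inf_corank.
Qed.

Lemma phi_le P Q : inf_rank P -> bi_infinite Q ->
  proj_le (phi P) (phi Q) <-> proj_le P Q.
Proof.
move=> P_inf Q_bi; rewrite !proj_le_inf_rankP //; last exact: phi_bi_infinite.
have [Q_inf _] := Q_bi; split=> orthQP Z Z_inf.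
  rewrite -(phi_orth Z_inf Q_inf) -(phi_orth Z_inf P_inf).
  by apply: orthQP; exact: phi_inf.
have [Y Y_inf <-] := phi_onto Z_inf.
by rewrite (phi_orth Y_inf Q_inf) (phi_orth Y_inf P_inf); exact: orthQP.
Qed.

Lemma phi_compl P : bi_infinite P -> phi (compl P) = compl (phi P).
Proof.
move=> P_bi; have [P_inf P_coinf] := P_bi.
have [Z Z_inf phiZ] := phi_onto (proj2 (phi_bi_infinite P_bi)).
apply: proj_le_anti.
  apply/proj_le_complP/proj_orthC; rewrite phi_orth //; exact: proj_orth_compl.
rewrite -phiZ phi_le //; last exact: bi_infinite_compl.
apply/proj_le_complP/proj_orthC; rewrite -phi_orth // phiZ.
exact: proj_orth_compl.
Qed.

Definition line_image A x v : Prop :=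
  [/\ ip v v = ip x x, phi A v = 0 & phi (adjoin A x) = adjoin (phi A) v].

Lemma exists_line_image A x : bi_infinite A -> A x = 0 ->
  exists v, line_image A x v.
Proof.
move=> A_bi Ax; have Ax_bi := bi_infinite_adjoin x A_bi.
have [A_inf A_coinf] := A_bi; have [Ax_inf _] := Ax_bi.
apply: same_angle_adjoin Ax _ _.
  by rewrite (phi_le A_inf Ax_bi); exact: le_adjoin.
by rewrite -phi_compl //; exact: phi_angle.
Qed.

Lemma line_image_perp A B x v : bi_infinite A -> inf_rank B -> proj_orth B A ->
  B x = 0 -> line_image A x v -> phi B v = 0.
Proof.
move=> A_bi B_inf BA Bx [_ _ phiAx]; rewrite -[v](adjoin_id (phi A)) -phiAx.
have [Ax_inf _] := bi_infinite_adjoin x A_bi.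
by apply: (proj2 (phi_orth B_inf Ax_inf)); exact: adjoin_orth.
Qed.

Lemma line_image_norm A B x y v w : bi_infinite A -> bi_infinite B ->
  proj_orth A B -> A x = 0 -> A y = 0 -> B x = 0 -> B y = 0 ->
  line_image A x v -> line_image B y w -> `|ip v w| = `|ip x y|.
Proof.
move=> A_bi B_bi AB Ax Ay Bx By v_img w_img.
have [ip_v Av phiAx] := v_img; have [ip_w Bw phiBy] := w_img.
have [A_inf _] := A_bi; have [B_inf _] := B_bi.
have [Ax_inf _] := bi_infinite_adjoin x A_bi.
have [By_inf _] := bi_infinite_adjoin y B_bi.
have [x0|/eqP x_neq0] := eqVneq x 0.
  have -> : v = 0 by apply: ip_eq0; rewrite ip_v x0 ip0l.
  by rewrite x0 !ip0l.
have [y0|/eqP y_neq0] := eqVneq y 0.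
  have -> : w = 0 by apply: ip_eq0; rewrite ip_w y0 ip0l.
  by rewrite y0 !ip0r.
have Aw : phi A w = 0 := line_image_perp B_bi A_inf AB Ay w_img.
have Bv : phi B v = 0 := line_image_perp A_bi B_inf (proj_orthC AB) Bx v_img.
have phi_AB : proj_orth (phi A) (phi B) by rewrite phi_orth.
have [W [W' [W_unit _ WK' eq_W]]] := phi_angle By_inf Ax_inf.
have [W_lin _ W_ip] := W_unit.
have {}eq_W u : (`|ip v w| ^+ 2 / (ip x x * ip y y)) *: line_proj v u =
    (`|ip x y| ^+ 2 / (ip x x * ip y y)) *: line_proj (W x) u.
  have := eq_W u; rewrite phiAx phiBy !compress_adjoin // ip_v ip_w.
  rewrite (semilinearZ (s := idfun) W_lin).
  by rewrite (isometric_onto_line_proj (s := idfun) W_unit WK').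
have xy_neq0 : (ip x x * ip y y)^-1 != 0.
  by rewrite invr_neq0 ?mulf_neq0 ?ip_neq0.
have line_neq0 z : ip z z = ip x x -> exists u, line_proj z u <> 0.
  move=> ip_z; exists z; rewrite line_proj_id => z0.
  by apply/x_neq0/ip_eq0; rewrite -ip_z z0 ip0l.
have /(mulIf xy_neq0) eq_sqr := proj_scale_inj eq_W (line_neq0 v ip_v)
  (line_neq0 (W x) (W_ip x x)).
by apply/eqP; rewrite -(eqrXn2 (n := 2)) // eq_sqr.
Qed.

Lemma line_image_unique_orth A B x v w : bi_infinite A -> bi_infinite B ->
  proj_orth A B -> A x = 0 -> B x = 0 -> line_image A x v -> line_image B x w ->
  line_proj v = line_proj w.
Proof.
move=> A_bi B_bi AB Ax Bx v_img w_img; apply/line_proj_same_ray/same_rayI.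
  by case: v_img w_img => -> _ _ [-> _ _].
rewrite (line_image_norm A_bi B_bi AB Ax Ax Bx Bx v_img w_img).
by case: w_img => -> _ _; exact: norm_ip.
Qed.

(* Both sides agree with the image of the line of [x] relative to the
   complement of [adjoin B x], which is orthogonal to [A] and [B]. *)
Lemma line_image_unique_le A B x v w : bi_infinite A -> bi_infinite B ->
  proj_le A B -> B x = 0 -> line_image A x v -> line_image B x w ->
  line_proj v = line_proj w.
Proof.
move=> A_bi B_bi le_AB Bx v_img w_img; pose C := compl (adjoin B x).
have C_bi : bi_infinite C by apply/bi_infinite_compl/bi_infinite_adjoin.
have Cx : C x = 0 by apply: compl_perp; exact: adjoin_id.
have CB : proj_orth C B by apply/proj_le_orthP/le_adjoin.
have [t t_img] := exists_line_image C_bi Cx.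
rewrite -(line_image_unique_orth C_bi B_bi CB Cx Bx t_img w_img).
have CA := proj_orth_le le_AB CB; have Ax := proj_le_perp le_AB Bx.
by rewrite -(line_image_unique_orth C_bi A_bi CA Cx Ax t_img v_img).
Qed.

Lemma line_image_unique A B x v w : bi_infinite A -> bi_infinite B ->
  A x = 0 -> B x = 0 -> line_image A x v -> line_image B x w ->
  line_proj v = line_proj w.
Proof.
move=> A_bi B_bi Ax Bx v_img w_img.
have [C [D [[C_inf D_inf] le_CA le_DB CD _]]] :=
  exists_orthogonal_subprojections [::] (proj1 A_bi) (proj1 B_bi).
have C_bi := proj_orth_bi_infinite C_inf D_inf CD.
have D_bi := proj_orth_bi_infinite D_inf C_inf (proj_orthC CD).
have Cx := proj_le_perp le_CA Ax; have Dx := proj_le_perp le_DB Bx.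
have [v' v'_img] := exists_line_image C_bi Cx.
have [w' w'_img] := exists_line_image D_bi Dx.
rewrite -(line_image_unique_le C_bi A_bi le_CA Ax v'_img v_img).
rewrite -(line_image_unique_le D_bi B_bi le_DB Bx w'_img w_img).
exact: line_image_unique_orth C_bi D_bi CD Cx Dx v'_img w'_img.
Qed.

Definition vector_image x v : Prop :=
  forall A, bi_infinite A -> A x = 0 -> line_image A x v.

Lemma exists_vector_image x : exists v, vector_image x v.
Proof.
have [A [B [A_bi _ _ AB_x]]] := exists_orthogonal_bi_infinite [:: x] V_inf.
have [Ax _] := AB_x x (mem_head _ _).
have [v v_img] := exists_line_image A_bi Ax; exists v => C C_bi Cx.
have [w w_img] := exists_line_image C_bi Cx.
have eq_vw := line_image_unique A_bi C_bi Ax Cx v_img w_img.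
have [ip_v _ _] := v_img; have [_ Cw phiCx] := w_img.
have Cv : phi C v = 0 by rewrite -[v]line_proj_id eq_vw proj_orth_line.
by split=> //; rewrite phiCx; apply: proj_ext => u; rewrite !adjoinE // eq_vw.
Qed.

Lemma vector_image_perp x v A : vector_image x v -> bi_infinite A -> A x = 0 ->
  phi A v = 0.
Proof. by move=> v_img A_bi /(v_img A A_bi)[]. Qed.

Lemma vector_image_fix x v A : vector_image x v -> bi_infinite A -> A x = x ->
  phi A v = v.
Proof.
move=> v_img A_bi Ax; apply: compl_eq0; rewrite -phi_compl //.
apply: vector_image_perp v_img _ _; first exact: bi_infinite_compl.
exact: compl_perp.
Qed.

Lemma vector_image_norm x y v w : vector_image x v -> vector_image y w ->
  `|ip v w| = `|ip x y|.
Proof.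
move=> v_img w_img.
have [A [B [A_bi B_bi AB AB_xy]]] :=
  exists_orthogonal_bi_infinite [:: x; y] V_inf.
have [Ax Bx] := AB_xy x (mem_head _ _).
have [Ay By] : A y = 0 /\ B y = 0 by apply: AB_xy; rewrite !inE eqxx orbT.
have v_A := v_img A A_bi Ax; have w_B := w_img B B_bi By.
exact: line_image_norm A_bi B_bi AB Ax Ay Bx By v_A w_B.
Qed.

Lemma vector_image_onto v : exists x, forall u, vector_image x u ->
  line_proj u = line_proj v.
Proof.
have [A' [B' [A'_bi _ _ AB_v]]] := exists_orthogonal_bi_infinite [:: v] V_inf.
have [A'v _] := AB_v v (mem_head _ _).
have [A A_bi phiA] := phi_onto_bi_infinite A'_bi.
have [Q Q_bi phiQ] := phi_onto_bi_infinite (bi_infinite_adjoin v A'_bi).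
have le_AQ : proj_le A Q.
  have [A_inf _] := A_bi; rewrite -(phi_le A_inf Q_bi) phiA phiQ.
  exact: le_adjoin.
have Q_angle := same_angle_sym (phi_angle (proj2 A_bi) (proj1 Q_bi)).
rewrite phi_compl // phiA phiQ in Q_angle.
have [x [_ Ax QE]] := same_angle_adjoin A'v le_AQ Q_angle.
exists x => u /(_ A A_bi Ax)[_]; rewrite -QE phiA phiQ => A'u eq_adjoin.
apply: proj_ext => t; apply: (addrI (A' t)).
by rewrite -!adjoinE // eq_adjoin.
Qed.

Section Implemented.
Variables (s : {rmorphism K -> K}) (U U' : V -> V).
Hypothesis s_idcj : id_or_cj cj s.
Hypothesis U_iso : isometric_onto ip s U.
Hypothesis UK : cancel U U'.
Hypothesis UK' : cancel U' U.
Hypothesis phi_U_bi_infinite : forall A, bi_infinite A ->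
  forall x, phi A (U x) = U (A x).

Let pull : projection -> projection := pullback s_idcj U_iso UK'.
Let pullE P x : U (pull P x) = P (U x).
Proof. exact: pullbackE. Qed.

Lemma le_pullback_phi P :
  inf_rank P -> ~ inf_rank (compl P) -> proj_le P (pull (phi P)).
Proof.
move=> P_inf P_ncoinf; apply: proj_le_of_comm => // [|A A_bi le_AP x].
  by move/inf_corank_pullback; rewrite phi_inf_corank.
apply: (can_inj UK); rewrite -[RHS](phi_U_bi_infinite A_bi) !pullE.
rewrite -(phi_U_bi_infinite A_bi).
exact: same_angle_le_comm (phi_angle P_inf (proj1 A_bi)) le_AP (U x).
Qed.

Lemma pullback_phi_le P :
  inf_rank P -> ~ inf_rank (compl P) -> proj_le (pull (phi P)) P.
Proof.
move=> P_inf P_ncoinf; apply: proj_le_of_comm => // [|A A_bi le_A x].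
  exact/inf_rank_pullback/phi_inf.
have phi_le_A : proj_le (phi A) (phi P).
  by move=> y; rewrite -[y]UK' (phi_U_bi_infinite A_bi) -pullE le_A.
have PA_angle := same_angle_sym (phi_angle P_inf (proj1 A_bi)).
exact: same_angle_le_comm PA_angle phi_le_A x.
Qed.

Lemma phi_implemented P x : inf_rank P -> phi P (U x) = U (P x).
Proof.
move=> P_inf; have [P_coinf|P_ncoinf] := pselect (inf_rank (compl P)).
  exact: phi_U_bi_infinite.
have pull_phi : pull (phi P) = P.
  by apply: proj_le_anti; [exact: pullback_phi_le | exact: le_pullback_phi].
by rewrite -(pullE (phi P)) pull_phi.
Qed.

End Implemented.

Lemma phi_bi_infinite_implemented (s : {rmorphism K -> K}) U T :
  Defs.semilinear s U -> (forall x, same_ray (U x) (T x)) ->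
  (forall x, vector_image x (T x)) ->
  forall A, bi_infinite A -> forall x, phi A (U x) = U (A x).
Proof.
move=> U_lin U_T T_img A A_bi x.
have fixU y : A y = y -> phi A (U y) = U y.
  move=> Ay; have [c _ ->] := U_T y.
  by rewrite projZ (vector_image_fix (T_img y)).
have killU y : A y = 0 -> phi A (U y) = 0.
  move=> Ay; have [c _ ->] := U_T y.
  by rewrite projZ (vector_image_perp (T_img y)) ?scaler0.
have -> : U x = U (x - A x) + U (A x) by rewrite -(semilinearD U_lin) subrK.
by rewrite projD (fixU _ (projK A x)) killU ?add0r // projB projK subrr.
Qed.

Lemma angle_preserving_implemented : exists s : {rmorphism K -> K}, exists U U',
  [/\ id_or_cj cj s, isometric_onto ip s U, cancel U U', cancel U' U &
      forall P, inf_rank P -> forall x, phi P (U x) = U (P x)].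
Proof.
have /choice[T T_img] := exists_vector_image.
have norm_T x y := vector_image_norm (T_img x) (T_img y).
have T_onto v : exists x c, v = c *: T x.
  have [x /(_ _ (T_img x)) eq_line] := vector_image_onto v; exists x.
  exists (ip v (T x) / ip (T x) (T x)).
  by rewrite -line_projE eq_line line_proj_id.
have [s [U [s_idcj U_iso U_T]]] := wigner_onto norm_T T_onto.
have [U' UK UK'] := isometric_onto_bijective s_idcj U_iso.
exists s, U, U'; split=> // P P_inf x.
have U_lin := isometric_onto_semilinear U_iso.
apply: (phi_implemented s_idcj U_iso UK UK') P_inf.
exact: phi_bi_infinite_implemented U_lin U_T T_img.
Qed.

End AnglePreserving.

Section Lift.
Variable phi : (V -> V) -> V -> V.
Hypothesis phi_inf : forall P : V -> V, proj_inf ip P -> proj_inf ip (phi P).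

(* Nothing is known about [phi P] when [P] has finite rank. *)
Definition lift_map P : projection :=
  if pselect (proj_inf ip P) is left P_inf
  then Projection (proj1 (phi_inf P_inf)) else P.

Lemma lift_mapE P : inf_rank P -> lift_map P = phi P :> (V -> V).
Proof. by rewrite /lift_map => /proj_infP P_inf; case: pselect. Qed.

Lemma lift_map_inf P : inf_rank P -> inf_rank (lift_map P).
Proof.
move=> P_inf; apply/proj_infP; rewrite lift_mapE //; exact/phi_inf/proj_infP.
Qed.

Lemma lift_map_onto :
  (forall Q : V -> V, proj_inf ip Q ->
    exists P : V -> V, proj_inf ip P /\ phi P = Q) ->
  forall Q, inf_rank Q -> exists2 P, inf_rank P & lift_map P = Q.
Proof.
move=> phi_onto Q /proj_infP/phi_onto[P [P_inf phiP]].
have bundle_inf : inf_rank (Projection (proj1 P_inf)) by apply/proj_infP.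
exists (Projection (proj1 P_inf)) => //.
by apply: proj_ext => x; rewrite lift_mapE //= phiP.
Qed.

End Lift.

End InnerProduct.

Theorem theorem4_body_of_inf_complete (K : numFieldType)
    (cj : {rmorphism K -> K}) (V : lmodType K) (ip : V -> V -> K) :
  (forall z, z * cj z = `|z| ^+ 2) -> inf_complete K -> theorem4_body cj ip.
Proof.
move=> mul_cj K_inf [ipP V_complete] V_inf phi phi_inf phi_onto phi_angle.
have lift_angle P Q : inf_rank P -> inf_rank Q ->
    same_angle ip P Q (lift_map phi_inf P) (lift_map phi_inf Q).
  move=> P_inf Q_inf; rewrite !lift_mapE //.
  by apply: phi_angle; exact/proj_infP.
have [s [U [U' [s_idcj U_iso UK UK' phiU]]]] :=
  angle_preserving_implemented mul_cj ipP K_inf V_complete V_inf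
    (lift_map_inf phi_inf) (lift_map_onto phi_inf phi_onto) lift_angle.
exists U, U'; split=> // [|P P_inf x].
  by case: s_idcj U_iso => ->; [left | right].
have bundle_inf : inf_rank (Projection (proj1 P_inf)) by exact/proj_infP.
by have := phiU _ bundle_inf (U' x); rewrite lift_mapE // UK'.
Qed.

(** * Real and complex scalars *)

Section RealComplex.
Variable R : realType.

Lemma real_inf_complete : inf_complete R.
Proof.
move=> S S_neq0 S_ge0; exists (inf S).
have S_lb : has_lbound S by exists 0.
by split=> [a|e e_gt0]; [exact: ge_inf | exact: inf_adherent].
Qed.

Lemma complex_inf_complete : inf_complete R[i].
Proof.
move=> S [a0 Sa0] S_ge0.
have ReE (a : R[i]) : 0 <= a -> (complex.Re a)%:C%C = a.
  by move=> a_ge0; rewrite RRe_real ?ger0_real.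
have [||g [g_le g_approx]] := real_inf_complete (S := fun r => S r%:C%C).
- by exists (complex.Re a0); rewrite ReE ?S_ge0.
- by move=> a /S_ge0; rewrite lecR.
exists g%:C%C; split=> [a Sa|e e_gt0].
  by rewrite -(ReE a (S_ge0 a Sa)) lecR; apply: g_le; rewrite ReE ?S_ge0.
move: (e_gt0); rewrite -(ReE e (ltW e_gt0)) ltcR => /g_approx[a Sa lt_a].
by exists a%:C%C => //; rewrite -rmorphD ltcR.
Qed.

End RealComplex.

Theorem theorem4 :
  (forall (R : realType) (V : lmodType R) (ip : V -> V -> R),
      theorem4_body (fun a : R => a) ip) /\
  (forall (R : realType) (V : lmodType R[i]) (ip : V -> V -> R[i]),
      theorem4_body (@conjc R) ip).
Proof.
split=> R V ip.
- apply: (@theorem4_body_of_inf_complete R idfun).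
    by move=> z; rewrite real_normK ?num_real.
  exact: real_inf_complete.
- apply: (@theorem4_body_of_inf_complete R[i] (@conjc R)).
    by move=> z; rewrite sqr_normc.
  exact: complex_inf_complete.
Qed.
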